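(* Let $\alpha>0$ be a fixed real number. Let $k=k(n)$ and $m=m(n)$ be functions of $n$ such that $k\geq 2$ and $m=\lfloor n^\alpha\rfloor$. (i) If $\liminf_{n\rightarrow\infty} \frac{k^2n}{m\log n}>1$, then asymptotically almost surely $G(n,m,k)$ is connected. (ii) If $\limsup_{n\rightarrow\infty} \frac{k^2n}{m\log n}<1$, then asymptotically almost surely $G(n,m,k)$ is not connected.
   Context: The uniform random intersection graph $G(n,m,k)$ (for positive integers $k\le m$) is the random graph on a set $V$ of $n$ nodes defined as follows: fix a set $M$ of $m$ colours; to each node $v\in V$ assign a subset $F_v\subseteq M$ of exactly $k$ distinct colours, chosen uniformly at random among all $k$-subsets of $M$, independently for different nodes; distinct nodes $u,v$ are joined by an edge if and only if $F_u\cap F_v\neq\emptyset$. An event holds asymptotically almost surely if its probability tends to $1$ as $n\rightarrow\infty$. Here $\log$ denotes the natural logarithm. *)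

(* Defs.v *)
From mathcomp Require Import all_boot.
From Stdlib Require Import Reals.
From Coquelicot Require Import Coquelicot.

Set Implicit Arguments.
Unset Strict Implicit.
Unset Printing Implicit Defensive.

(* A colour assignment: node v in 'I_n gets a set F v of colours from 'I_m. *)
Definition assignment (n m : nat) := {ffun 'I_n -> {set 'I_m}}.

Definition valid_assignment (n m k : nat) (F : assignment n m) : bool :=
  [forall v, #|F v| == k].

Definition rig_adj (n m : nat) (F : assignment n m) : rel 'I_n :=
  fun u v => (u != v) && (F u :&: F v != set0).

Definition rig_connected (n m : nat) (F : assignment n m) : bool :=
  [forall u, forall v, connect (rig_adj F) u v].

(* Probability of an event under G(n,m,k): uniform over valid assignments
   (the product of uniform k-subsets, independent across nodes). *)
Definition rig_prob (n m k : nat) (E : pred (assignment n m)) : R :=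
  (INR #|[set F : assignment n m | valid_assignment k F && E F]|
   / INR #|[set F : assignment n m | valid_assignment k F]|)%R.

(* Main.v *)
Require Import Defs.
From mathcomp Require Import all_boot.
From Stdlib Require Import Reals.
From Coquelicot Require Import Coquelicot.
From Stdlib Require Import Lra Lia.
From mathcomp Require all_order all_algebra zify ring lra Rstruct.

(** Connectivity.  If the graph is disconnected, some set [S] of [1 <= s <= n/2] nodes
    shares no colour with the other nodes.  Given that the nodes of [S] use [c]
    colours, this has probability at most [(1 - c/m)^(k (n - s)) <= y^c] with
    [y = (1 - 1/m)^(k (n - s))].  Exposing the colours of [S] one at a time gives
    [E y^c <= (y + (1 - y) k s / m)^(k s)], which beats the number of sets [S] as long
    as [k s / m] is small.  When [k s] is of order [m], splitting according to whether
    [c <= a] for [a = theta m] is enough.  This works for [alpha >= 1], where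
    [k >= sqrt (log n)].  For [alpha < 1] one takes instead the union bound over
    sets [A] of [a <= m/2] colours such that each node has all or none of its colours
    in [A]; for [k >= 2] this has probability at most [(1 - a/m)^n].

    Disconnectivity.  The number [X] of isolated nodes has mean [n q^(n-1)], where
    [q >= 1 - k^2/m] is the probability that two nodes are not adjacent, and
    [C(m-2k,k) C(m,k) <= C(m-k,k)^2] shows that distinct nodes are isolated
    together with probability at most [q^(2n-3)]; Chebyshev's inequality then gives
    [P(X = 0) <= 1 / E X + 1/q - 1]. *)

Set Implicit Arguments.
Unset Strict Implicit.
Unset Printing Implicit Defensive.

(* The module confines the imports below: in the theorem, [%R] is [R_scope]. *)
Module Counting.

Import all_order all_algebra Rstruct mathcomp.zify.zify.
Import mathcomp.algebra_tactics.ring mathcomp.algebra_tactics.lra.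
Import ssrnat.
Import Order.TTheory GRing.Theory Num.Theory.

(** * Averages over assignments, and resampling the colours of one node *)

Section Average.

Local Open Scope ring_scope.

Variables (K : realFieldType) (n m k : nat).
Hypothesis km : (k <= m)%nat.

Implicit Types (F : assignment n m) (A B U : {set 'I_m}) (S : {set 'I_n}).

Definition update F v A : assignment n m :=
  [ffun w => if w == v then A else F w].

Definition set_mean (f : {set 'I_m} -> K) : K :=
  (\sum_(A : {set 'I_m} | #|A| == k) f A) / 'C(m, k)%:R.

Definition rig_mean (f : assignment n m -> K) : K :=
  (\sum_(F | valid_assignment k F) f F) / ('C(m, k) ^ n)%:R.

Lemma update_same F v A : update F v A v = A.
Proof. by rewrite ffunE eqxx. Qed.

Lemma update_other F v A w : w != v -> update F v A w = F w.
Proof. by rewrite ffunE => /negbTE ->. Qed.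

Lemma updateK F v A : update (update F v A) v (F v) = F.
Proof. by apply/ffunP => w; rewrite !ffunE; case: eqVneq => // ->. Qed.

(** Exchanging [F v] with [A] preserves the pairs of a valid assignment and a [k]-subset, which
    licenses the reindexing in [rig_mean_resample]. *)
Lemma valid_updateP F v A :
  (valid_assignment k (update F v A) && (#|F v| == k)) =
  (valid_assignment k F && (#|A| == k)).
Proof.
apply/andP/andP => -[/forallP hF hA].
- split; last by have := hF v; rewrite update_same.
  apply/forallP => w; have [->//|wv] := eqVneq w v.
  by have := hF w; rewrite update_other.
- split; last exact: hF.
  apply/forallP => w; have [->|wv] := eqVneq w v; first by rewrite update_same.
  by rewrite update_other.
Qed.

Lemma card_valid_assignment :
  #|[set F : assignment n m | valid_assignment k F]| = ('C(m, k) ^ n)%nat.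
Proof.
rewrite -[m in 'C(m, _)]card_ord -card_draws -[X in (_ ^ X)%nat](card_ord n).
rewrite -card_ffun_on.
apply: eq_card => F; rewrite inE; apply/forallP/ffun_onP => h v; have := h v;
  by rewrite inE.
Qed.

Let C_gt0 : 0 < 'C(m, k)%:R :> K.
Proof. by rewrite ltr0n bin_gt0. Qed.

Let Cn_gt0 : 0 < ('C(m, k) ^ n)%:R :> K.
Proof. by rewrite ltr0n expn_gt0 bin_gt0 km. Qed.

Lemma card_k_subsets : #|[pred A : {set 'I_m} | #|A| == k]| = 'C(m, k).
Proof.
rewrite -[m in 'C(m, _)]card_ord -card_draws.
by apply: eq_card => A; rewrite !inE.
Qed.

Lemma rig_mean_cst c : rig_mean (fun=> c) = c.
Proof.
rewrite /rig_mean sumr_const -[#|_|]cardsE card_valid_assignment.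
by rewrite -[c *+ _]mulr_natr mulfK // gt_eqF.
Qed.

Lemma le_set_mean f g :
  (forall A, #|A| = k -> f A <= g A) -> set_mean f <= set_mean g.
Proof.
move=> fg; rewrite ler_pM2r ?invr_gt0 //; apply: ler_sum => A /eqP.
exact: fg.
Qed.

Lemma le_rig_mean f g :
  (forall F, valid_assignment k F -> f F <= g F) -> rig_mean f <= rig_mean g.
Proof. by move=> fg; rewrite ler_pM2r ?invr_gt0 //; apply: ler_sum. Qed.

Lemma eq_rig_mean f g :
  (forall F, valid_assignment k F -> f F = g F) -> rig_mean f = rig_mean g.
Proof. by move=> fg; congr (_ / _); apply: eq_bigr. Qed.

Lemma set_meanD f g : set_mean (fun A => f A + g A) = set_mean f + set_mean g.
Proof. by rewrite /set_mean big_split mulrDl. Qed.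

Lemma rig_meanD f g : rig_mean (fun F => f F + g F) = rig_mean f + rig_mean g.
Proof. by rewrite /rig_mean big_split mulrDl. Qed.

Lemma rig_meanZ c f : rig_mean (fun F => c * f F) = c * rig_mean f.
Proof. by rewrite /rig_mean -mulr_sumr mulrA. Qed.

Lemma rig_mean_sum (I : finType) (P : pred I) (f : I -> assignment n m -> K) :
  rig_mean (fun F => \sum_(i | P i) f i F) = \sum_(i | P i) rig_mean (f i).
Proof. by rewrite /rig_mean exchange_big mulr_suml. Qed.

(** Exchanging [F v] with a [k]-subset [A] is an involution on such pairs, so [F v] may be replaced
    by a fresh uniform subset. Every use of independence between nodes reduces to this. *)
Lemma rig_mean_resample v f :
  rig_mean f = rig_mean (fun F => set_mean (fun A => f (update F v A))).
Proof.
congr (_ / _); rewrite /set_mean -mulr_suml.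
apply: (canRL (mulfK (lt0r_neq0 C_gt0))); rewrite mulr_natr.
rewrite pair_big /=.
pose h (p : assignment n m * {set 'I_m}) := (update p.1 v p.2, p.1 v).
have hK : involutive h by case=> F A; rewrite /h /= updateK update_same.
rewrite (reindex_inj (inv_inj hK)) /h /=.
rewrite [RHS](eq_bigl (fun p : assignment n m * {set 'I_m} => valid_assignment k p.1 && (#|p.2| == k))); last first.
  by move=> p; exact: valid_updateP.
rewrite -(pair_big (valid_assignment k) (fun A => #|A| == k)
  (fun F A => f (update (update F v A) v (F v)))) /=.
rewrite -sumrMnl; apply: eq_bigr => F _.
by under eq_bigr => A _ do rewrite updateK; rewrite sumr_const card_k_subsets.
Qed.

(* Conditionally on a statistic [g] of the other coordinates, the coordinates
   in [r] are independent and uniform. *)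
Lemma rig_mean_prod (X : Type) (g : assignment n m -> X) (Q : X -> pred {set 'I_m})
    (r : seq 'I_n) (h : X -> K) :
    uniq r -> {in r, forall v F A, g (update F v A) = g F} ->
  rig_mean (fun F => h (g F) * (all (fun v => Q (g F) (F v)) r)%:R) =
  rig_mean (fun F => h (g F) * set_mean (fun A => (Q (g F) A)%:R) ^+ size r).
Proof.
elim: r h => [|v r IH] h /=; first by [].
move=> /andP[vr ur] hg.
pose q x := set_mean (fun A => (Q x A)%:R).
under [RHS]eq_rig_mean => F _ do rewrite exprS mulrA.
rewrite -(IH (fun x => h x * q x)) //; last first.
  by move=> w wr; apply: hg; rewrite inE wr orbT.
rewrite (rig_mean_resample v); apply: eq_rig_mean => F _.
have gv A : g (update F v A) = g F by apply: hg; rewrite inE eqxx.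
transitivity (set_mean (fun A => h (g F) * (all (fun v => Q (g F) (F v)) r)%:R
   * (Q (g F) A)%:R)).
  congr (_ / _); apply: eq_bigr => A _; rewrite gv update_same.
  rewrite (@eq_in_all _ _ (fun v0 => Q (g F) (F v0))); last first.
    by move=> w wr; rewrite update_other //; apply: contraNneq vr => <-.
  by case: (Q _ _); case: all; rewrite /= ?(mulr0, mulr1).
by rewrite /set_mean -mulr_sumr /q /set_mean; ring.
Qed.

Lemma sum_k_subsets_bool (Q : pred {set 'I_m}) :
  \sum_(A : {set 'I_m} | #|A| == k) (Q A)%:R
  = #|[set A | Q A & #|A| == k]|%:R :> K.
Proof.
rewrite -natr_sum; congr (_%:R).
rewrite -sum1_card [RHS]big_mkcond [LHS]big_mkcond /=; apply: eq_bigr => A _.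
by rewrite inE; case: (Q A); case: eqP.
Qed.

Lemma set_mean_subset B :
  set_mean (fun A => (A \subset B)%:R) = 'C(#|B|, k)%:R / 'C(m, k)%:R.
Proof.
rewrite /set_mean sum_k_subsets_bool; congr (_%:R / _).
by rewrite -cards_draws; apply: eq_card => A; rewrite !inE.
Qed.

Lemma set_mean_disjoint B :
  set_mean (fun A => [disjoint A & B]%:R) = 'C(m - #|B|, k)%:R / 'C(m, k)%:R.
Proof.
have -> : (m - #|B|)%N = #|~: B| by rewrite [RHS]cardsCs setCK card_ord.
rewrite -set_mean_subset; congr (_ / _); apply: eq_bigr => A _.
by rewrite disjoints_subset.
Qed.

End Average.

(** * Random [k]-subsets of a set of [m] colours *)

Section Subsets.

Local Open Scope ring_scope.

Variables (K : realFieldType) (m : nat).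

Implicit Types (A B U : {set 'I_m}).

(** After multiplication by [k!] both binomials become falling factorials, whose factors compare one
    by one: [(a - i) m <= (m - i) a], as [a <= m]. *)
Lemma bin_mul_expn_le a k : (a <= m)%N -> ('C(a, k) * m ^ k <= 'C(m, k) * a ^ k)%N.
Proof.
move=> am; rewrite -(leq_pmul2l (fact_gt0 k)) !mulnA ![(k`! * _)%N]mulnC !bin_ffact.
elim: k => [|k IH]; first by rewrite !ffactn0.
rewrite !ffactnSr !expnS.
rewrite [leqLHS](_ : _ = (a ^_ k * m ^ k) * ((a - k) * m))%N; last by ring.
rewrite [leqRHS](_ : _ = (m ^_ k * a ^ k) * ((m - k) * a))%N; last by ring.
apply: leq_mul IH _; nia.
Qed.

Lemma bin_ratio_le a k : (a <= m)%N -> (k <= m)%N ->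
  'C(a, k)%:R / 'C(m, k)%:R <= (a%:R / m%:R) ^+ k :> K.
Proof.
move=> am km; have [m0|m0] := posnP m.
  move: am km; rewrite m0 !leqn0 => /eqP-> /eqP->.
  by rewrite bin0 divr1 expr0.
rewrite expr_div_n ler_pdivrMr ?ltr0n ?bin_gt0 // mulrAC.
rewrite ler_pdivlMr ?exprn_gt0 ?ltr0n // -!natrX -!natrM ler_nat [leqRHS]mulnC.
exact: bin_mul_expn_le.
Qed.

(** Both sides sum over pairs of a [k.+1]-subset [A] and an element [a] of it, with [B = A :\ a]. *)
Lemma sum_subsets_succ k (f : {set 'I_m} -> K) :
  \sum_(A : {set 'I_m} | #|A| == k.+1) f A *+ k.+1 =
  \sum_(B : {set 'I_m} | #|B| == k) \sum_(a | a \notin B) f (a |: B).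
Proof.
transitivity (\sum_(A : {set 'I_m} | #|A| == k.+1) \sum_(a in A) f A).
  by apply: eq_bigr => A /eqP cA; rewrite sumr_const cA.
rewrite (exchange_big_dep xpredT) //= [RHS](exchange_big_dep xpredT) //=.
apply: eq_bigr => a _.
rewrite (reindex_onto (fun B => a |: B) (fun A => A :\ a)) /=; last first.
  by move=> A /andP[_ aA]; rewrite setD1K.
apply: eq_bigl => B; rewrite setU11 andbT.
have [aB|aB] := boolP (a \in B).
  rewrite andbF; apply/negbTE/negP => /andP[_ /eqP BE].
  by move: aB; rewrite -BE setD11.
by rewrite setU1K // eqxx !andbT cardsU1 aB add1n eqSS.
Qed.

(* Adding the elements of the random set one at a time, the next one falls
   in [U] with conditional probability at most [x]. *)
Lemma sum_expr_union k U (x y : K) :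
    0 <= y <= 1 -> 0 <= x <= 1 -> (#|U| + k)%:R <= x * m%:R ->
  \sum_(A : {set 'I_m} | #|A| == k) y ^+ #|A :|: U| <=
  'C(m, k)%:R * (y ^+ #|U| * (y + (1 - y) * x) ^+ k).
Proof.
move=> /andP[y0 y1] /andP[x0 x1]; elim: k => [|k IH] hx.
  rewrite bin0 expr0 !mul1r mulr1 (big_pred1 set0) ?set0U // => A.
  by rewrite cards_eq0.
set z := y + (1 - y) * x in IH *.
have z0 : 0 <= z by rewrite addr_ge0 // mulr_ge0 // subr_ge0.
have km : (k < m)%N.
  rewrite -(ler_nat K); apply: le_trans (_ : x * m%:R <= _); last first.
    by rewrite ler_piMl.
  by apply: le_trans hx; rewrite ler_nat leq_addl.
have {}IH := IH (le_trans _ hx).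
rewrite ler_nat addnS leqnSn in IH; have {}IH := IH isT.
have k1 : 0 < k.+1%:R :> K by rewrite ltr0n.
rewrite -(ler_pM2l k1) [leLHS]mulr_natl.
rewrite -sumrMnl sum_subsets_succ.
rewrite [leRHS]mulrA -natrM mul_bin_left natrM exprS.
have -> : (m - k)%:R * 'C(m, k)%:R * (y ^+ #|U| * (z * z ^+ k)) =
  ((m - k)%:R * z) * ('C(m, k)%:R * (y ^+ #|U| * z ^+ k)) by ring.
apply: le_trans (ler_wpM2l (mulr_ge0 (ler0n _ _) z0) IH).
rewrite mulr_sumr; apply: ler_sum => B /eqP cB.
(* A colour already in [U] leaves the union unchanged; any other new one multiplies the power by
   [y]. *)
have -> : \sum_(a | a \notin B) y ^+ #|(a |: B) :|: U| =
   (\sum_(a | a \notin B) (if a \in U then 1 else y)) * y ^+ #|B :|: U|.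
  rewrite mulr_suml; apply: eq_bigr => a aB.
  rewrite -setUA cardsU1 inE (negbTE aB) /=.
  by case: (a \in U) => /=; rewrite ?mul1r // exprS.
apply: ler_wpM2r; first exact: exprn_ge0.
rewrite (bigID (mem U)) /=.
rewrite (eq_bigr (fun=> 1)) => [|a /andP[_ ->] //].
rewrite [X in _ + X](eq_bigr (fun=> y)) => [|a /andP[_ /negbTE->] //].
rewrite !sumr_const -[y *+ _]mulr_natr.
set p := #|_|; set q := #|_|.
have pq : (p + q = m - k)%N.
  have -> : (m - k)%N = #|~: B| by rewrite [RHS]cardsCs setCK card_ord cB.
  rewrite -(cardID (mem U) (~: B)); congr (_ + _)%N; apply: eq_card => a;
  by rewrite [LHS]unfold_in !inE //= andbC.
have pU : (p <= #|U|)%N.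
  by apply/subset_leq_card/subsetP => a; rewrite unfold_in => /andP[].
rewrite -pq natrD.
(* Of the [p + q = m - k] free colours, [p] lie in [U]. Since [|U| + k + 1 <= x m] and [x <= 1],
   they make up at most the fraction [x]. *)
have hq : p%:R <= x * (p%:R + q%:R).
  have e : p%:R + q%:R = m%:R - k%:R :> K by rewrite -natrD pq natrB // ltnW.
  rewrite e; move: hx; rewrite addnS -addn1 !natrD.
  have := pU; rewrite -(ler_nat K) => ?.
  have : x * k%:R <= k%:R by rewrite ler_piMl.
  by rewrite mulrBr; lra.
rewrite /z; have : 0 <= 1 - y by rewrite subr_ge0.
by move=> y2; have := ler_wpM2l y2 hq; lra.
Qed.

Lemma set_mean_expr_union k U (x y : K) :
    0 <= y <= 1 -> 0 <= x <= 1 -> (#|U| + k)%:R <= x * m%:R ->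
  set_mean k (fun A => y ^+ #|A :|: U|) <= y ^+ #|U| * (y + (1 - y) * x) ^+ k.
Proof.
move=> y01 x01 hx; have := sum_expr_union y01 x01 hx.
case/andP: x01 => x0 x1.
have km : (k <= m)%N.
  rewrite -(ler_nat K); apply: le_trans (_ : x * m%:R <= _).
    by apply: le_trans hx; rewrite ler_nat leq_addl.
  by rewrite ler_piMl.
by rewrite /set_mean ler_pdivrMr ?ltr0n ?bin_gt0 // mulrC.
Qed.

Lemma bernoulli_expr (z : K) c : 0 <= z <= 1 -> 1 - c%:R * z <= (1 - z) ^+ c.
Proof.
move=> /andP[z0 z1]; elim: c => [|c IH]; first by rewrite mul0r subr0 expr0.
rewrite exprS; have z2 : 0 <= 1 - z by lra.
have := ler_wpM2l z2 IH; apply: le_trans.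
rewrite -natr1; have : 0 <= c%:R * z * z by rewrite !mulr_ge0.
lra.
Qed.

Lemma subset_of_card a U : (#|U| <= a <= m)%N -> exists2 B : {set 'I_m}, U \subset B & #|B| == a.
Proof.
move=> /andP[Ua am].
have : (0 < #|[set A : {set 'I_m} | A \subset ~: U & #|A| == m - a]|)%N.
  rewrite cards_draws bin_gt0 [leqRHS]cardsCs setCK card_ord; lia.
case/card_gt0P => A; rewrite inE => /andP[AU /eqP cA].
exists (~: A); first by rewrite -setCS setCK.
by rewrite cardsCs setCK card_ord cA subKn.
Qed.

End Subsets.

(** * Probability that a set of nodes shares no colour with the rest *)

Section Separation.

Local Open Scope ring_scope.

Variables (K : realFieldType) (n m k : nat).
Hypothesis km : (k <= m)%N.

Implicit Types (F : assignment n m) (A B U : {set 'I_m}) (S : {set 'I_n}).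

Definition colours F S : {set 'I_m} := \bigcup_(u in S) F u.

Definition separated S F : bool :=
  [forall u in S, forall v in ~: S, [disjoint F u & F v]].

Local Notation mean := (@rig_mean K n m k).

Lemma separatedE S F :
  separated S F = all (fun v => [disjoint F v & colours F S]) (enum (~: S)).
Proof.
apply/forallP/allP => [h v|h u].
  rewrite mem_enum => vS; rewrite /colours bigcup_disjoint // => u uS.
  rewrite disjoint_sym; by have /implyP/(_ uS)/forallP/(_ v)/implyP/(_ vS) := h u.
apply/implyP => uS; apply/forallP => v; apply/implyP => vS.
have := h v; rewrite mem_enum => /(_ vS); rewrite disjoint_sym.
by apply: disjointWl; apply: bigcup_sup.
Qed.

Lemma colours_update F S v A : v \notin S -> colours (update F v A) S = colours F S.
Proof.
move=> vS; apply: eq_bigr => u uS; rewrite update_other //.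
by apply: contraNneq vS => <-.
Qed.

(** Once [colours F S] is fixed, with [c] elements, the nodes outside [S] avoid it independently,
    each with probability [C(m - c, k) / C(m, k) <= (1 - c/m)^k]. *)
Lemma mean_separated_le S : (0 < m)%N ->
  mean (fun F => (separated S F)%:R) <=
  mean (fun F => (1 - #|colours F S|%:R / m%:R) ^+ (k * (n - #|S|))).
Proof.
move=> m0.
under eq_rig_mean => F _ do rewrite separatedE -[_%:R]mul1r.
rewrite (rig_mean_prod km (g := fun F => colours F S)
  (fun U A => [disjoint A & U]) (fun=> 1)) ?enum_uniq //; last first.
  by move=> v; rewrite mem_enum inE => vS F A; rewrite colours_update.
apply: le_rig_mean => // F _; rewrite mul1r -cardE.
have -> : #|~: S| = (n - #|S|)%N by rewrite cardsCs setCK card_ord.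
have U_m : (#|colours F S| <= m)%N by rewrite -[leqRHS](card_ord m) max_card.
rewrite set_mean_disjoint // exprM; apply: lerXn2r; rewrite ?nnegrE.
- by rewrite divr_ge0.
- rewrite exprn_ge0 // subr_ge0 ler_pdivrMr ?ltr0n // mul1r ler_nat //.
- have := bin_ratio_le K (leq_subr #|colours F S| m) km; congr (_ <= _ ^+ _).
  by rewrite natrB // mulrBl divff // pnatr_eq0 -lt0n.
Qed.

(** Induction on the nodes: when [v] is resampled, the others use at most [k * size r] colours, so
    [set_mean_expr_union] yields one factor [(y + (1 - y) x)^k]. *)
Lemma mean_expr_colours_seq (r : seq 'I_n) (x y : K) :
    uniq r -> 0 <= y <= 1 -> 0 <= x <= 1 -> (k * size r)%:R <= x * m%:R ->
  mean (fun F => y ^+ #|\bigcup_(u <- r) F u|) <= (y + (1 - y) * x) ^+ (k * size r).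
Proof.
move=> + y01 x01; elim: r => [|v r IH] /=.
  move=> _ _; under eq_rig_mean => F _ do rewrite big_nil cards0.
  by rewrite rig_mean_cst // muln0 !expr0.
move=> /andP[vr ur] hx.
have z0 : 0 <= y + (1 - y) * x.
  case/andP: y01 => y0 y1; case/andP: x01 => x0 x1.
  by rewrite addr_ge0 // mulr_ge0 // subr_ge0.
rewrite (rig_mean_resample km v) mulnS exprD.
apply: le_trans (_ : mean (fun F => (y + (1 - y) * x) ^+ k *
   y ^+ #|\bigcup_(u <- r) F u|) <= _); last first.
  rewrite rig_meanZ ler_wpM2l ?exprn_ge0 // IH //; apply: le_trans hx.
  by rewrite ler_nat leq_mul2l leqnSn orbT.
apply: le_rig_mean => // F /forallP vF.
have cU : (#|\bigcup_(u <- r) F u| <= k * size r)%N.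
  elim: (r) => [|u r' IH']; first by rewrite big_nil cards0.
  rewrite big_cons /= mulnS; apply: leq_trans (leq_card_setU _ _) _.
  by rewrite leq_add // (eqP (vF u)).
rewrite [leLHS](_ : _ = set_mean k (fun A => y ^+ #|A :|: \bigcup_(u <- r) F u|)).
  rewrite mulrC; apply: set_mean_expr_union => //; apply: le_trans hx.
  by rewrite ler_nat mulnS addnC leq_add2l.
congr (_ / _); apply: eq_bigr => A _; rewrite big_cons update_same.
congr (_ ^+ #|_ :|: _|); apply: eq_big_seq => w wr; rewrite update_other //.
by apply: contraNneq vr => <-.
Qed.

Lemma mean_expr_colours S (x y : K) :
    0 <= y <= 1 -> 0 <= x <= 1 -> (k * #|S|)%:R <= x * m%:R ->
  mean (fun F => y ^+ #|colours F S|) <= (y + (1 - y) * x) ^+ (k * #|S|).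
Proof.
move=> y01 x01 hx; rewrite cardE.
under eq_rig_mean => F _ do rewrite /colours -big_enum.
by apply: mean_expr_colours_seq; rewrite ?enum_uniq // -cardE.
Qed.

(** Bernoulli's inequality [1 - c/m <= (1 - 1/m)^c] turns the bound of [mean_separated_le] into a
    power [y^c]. Any upper bound [y] is allowed, so that an exponential can be substituted later. *)
Lemma mean_separated_expr S (x y : K) : (0 < m)%N ->
    (1 - m%:R^-1) ^+ (k * (n - #|S|)) <= y <= 1 ->
    0 <= x <= 1 -> (k * #|S|)%:R <= x * m%:R ->
  mean (fun F => (separated S F)%:R) <= (y + (1 - y) * x) ^+ (k * #|S|).
Proof.
move=> m0 /andP[yl yr] x01 hx.
have m1 : 0 <= (m%:R^-1 : K) <= 1.
  by rewrite invr_ge0 ler0n /= invf_le1 ?ltr0n // ler1n.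
have m2 : 0 <= 1 - m%:R^-1 :> K by rewrite subr_ge0; case/andP: m1.
have y0 : 0 <= y by apply: le_trans yl; rewrite exprn_ge0.
apply: le_trans (mean_expr_colours _ x01 hx); last by rewrite y0.
apply: le_trans (mean_separated_le S m0) _; apply: le_rig_mean => // F _.
apply: le_trans (_ : ((1 - m%:R^-1) ^+ (k * (n - #|S|))) ^+ #|colours F S| <= _).
  rewrite exprAC; apply: lerXn2r; rewrite ?nnegrE ?exprn_ge0 //.
    rewrite subr_ge0 ler_pdivrMr ?ltr0n // mul1r ler_nat.
    by rewrite -[leqRHS](card_ord m) max_card.
  exact: bernoulli_expr.
by apply: lerXn2r; rewrite ?nnegrE ?exprn_ge0.
Qed.

Lemma mean_all_subset (r : seq 'I_n) (B : {set 'I_m}) : uniq r ->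
  mean (fun F => (all (fun v => F v \subset B) r)%:R) =
  ('C(#|B|, k)%:R / 'C(m, k)%:R) ^+ size r.
Proof.
move=> ur; under eq_rig_mean => F _ do rewrite -[_%:R]mul1r.
rewrite (rig_mean_prod km (g := fun=> tt) (fun=> fun A => A \subset B)
  (fun=> 1)) // rig_meanZ rig_mean_cst // mul1r set_mean_subset //.
Qed.

(** If [S] uses at most [a] colours, they lie in some [a]-set [B], and a union bound over [B] gives
    the first term. Otherwise [mean_separated_le] gives the second. *)
Lemma mean_separated_threshold S a : (0 < m)%N -> (a <= m)%N ->
  mean (fun F => (separated S F)%:R) <=
  'C(m, a)%:R * (a%:R / m%:R) ^+ (k * #|S|) + (1 - a%:R / m%:R) ^+ (k * (n - #|S|)).
Proof.
move=> m0 am; apply: le_trans (mean_separated_le S m0) _.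
have frac_le1 c : (c <= m)%N -> 0 <= 1 - c%:R / m%:R :> K.
  by move=> cm; rewrite subr_ge0 ler_pdivrMr ?ltr0n // mul1r ler_nat.
set T := (1 - a%:R / m%:R) ^+ _.
apply: le_trans (_ : mean (fun F => (\sum_(B : {set 'I_m} | #|B| == a)
   (all (fun v => F v \subset B) (enum S))%:R) + T) <= _).
  apply: le_rig_mean => // F _.
  have U_m : (#|colours F S| <= m)%N by rewrite -[leqRHS](card_ord m) max_card.
  have [Ua|aU] := leqP #|colours F S| a.
    have [B UB cB] : exists2 B : {set 'I_m}, colours F S \subset B & #|B| == a.
      by apply: subset_of_card; rewrite Ua.
    rewrite (bigD1 B) //= (_ : all _ _ = true); last first.
      apply/allP => v; rewrite mem_enum => vS; apply: subset_trans UB.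
      exact: bigcup_sup.
    rewrite -addrA ler_wpDr ?addr_ge0 ?exprn_ge0 ?sumr_ge0 ?frac_le1 //.
    rewrite exprn_ile1 ?frac_le1 // lerBlDr lerDl divr_ge0 //.
  apply: ler_wpDl; first by apply: sumr_ge0.
  apply: lerXn2r; rewrite ?nnegrE ?frac_le1 //.
  by rewrite lerB // ler_wpM2r ?invr_ge0 // ler_nat ltnW.
rewrite rig_meanD rig_mean_cst // lerD2r rig_mean_sum.
rewrite -[m in 'C(m, _)]card_ord -card_draws mulr_natl -sumr_const.
rewrite [leRHS](eq_bigl (fun B : {set 'I_m} => #|B| == a)) => [|B]; last by rewrite inE.
apply: ler_sum => B /eqP cB; rewrite mean_all_subset ?enum_uniq // -cardE cB exprM.
by apply: lerXn2r; rewrite ?nnegrE ?divr_ge0 ?exprn_ge0 ?divr_ge0 // bin_ratio_le.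
Qed.

End Separation.

(** * Union bounds over nonempty sets of at most half size *)

Section UnionBounds.

Local Open Scope ring_scope.

Variable K : realFieldType.

Lemma sum_geometric_le (N : nat) (rho : K) :
  0 <= rho <= 2^-1 -> \sum_(i < N) rho ^+ i <= 2.
Proof.
move=> /andP[r0 r1]; have := subrX1 rho N.
have rN : 0 <= rho ^+ N by exact: exprn_ge0.
have : 0 <= \sum_(i < N) rho ^+ i by apply: sumr_ge0 => i _; exact: exprn_ge0.
nra.
Qed.

(** The sets of each size [s] contribute at most [rho^s] together, so the sum is bounded by the
    geometric series from [s = 1]. *)
Lemma sum_small_subsets_le (N : nat) (f : {set 'I_N} -> K) (rho : K) :
    0 <= rho <= 2^-1 ->
    (forall S : {set 'I_N}, (0 < #|S|)%N -> (#|S|.*2 <= N)%N ->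
       'C(N, #|S|)%:R * f S <= rho ^+ #|S|) ->
  \sum_(S : {set 'I_N} | (0 < #|S|)%N && (#|S|.*2 <= N)%N) f S
    <= 2 * rho.
Proof.
move=> rho01 hf; have /andP[r0 _] := rho01.
have cS (S : {set 'I_N}) : (#|S| <= N)%N by rewrite -[leqRHS](card_ord N) max_card.
have C0 s : (s <= N)%N -> 0 < 'C(N, s)%:R :> K by move=> h; rewrite ltr0n bin_gt0.
pose g s : K := rho ^+ s / 'C(N, s)%:R.
have g0 s : 0 <= g s by rewrite divr_ge0 // exprn_ge0.
apply: le_trans (_ : \sum_(S : {set 'I_N} | (0 < #|S|)%N) g #|S| <= _).
  apply: le_trans (_ : \sum_(S : {set 'I_N} |
    (0 < #|S|)%N && (#|S|.*2 <= N)%N) g #|S| <= _).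
    apply: ler_sum => S /andP[S0 S2]; rewrite ler_pdivlMr ?C0 // mulrC.
    exact: hf.
  rewrite [leRHS](bigID (fun S : {set 'I_N} => (#|S|.*2 <= N)%N)) /= lerDl.
  exact: sumr_ge0.
rewrite (partition_big (fun S : {set 'I_N} => inord #|S| : 'I_N.+1)
  (fun s : 'I_N.+1 => (0 < s)%N)) /=; last first.
  by move=> S S0; rewrite inordK // ltnS.
rewrite (eq_bigr (fun s : 'I_N.+1 => rho ^+ s)); last first.
  move=> s s0.
  rewrite (eq_bigl (fun S => S \in [set S : {set 'I_N} | #|S| == s])); last first.
    move=> S; rewrite inE -val_eqE /= inordK ?ltnS //.
    by case: (#|S| =P s :> nat) => [->|]; rewrite ?andbF // andbT.
  rewrite (eq_bigr (fun=> g s)) => [|S]; last by rewrite inE => /eqP->.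
  rewrite sumr_const card_draws card_ord -[_ *+ _]mulr_natr divfK //.
  by rewrite gt_eqF // C0 // -ltnS.
rewrite big_mkcond big_ord_recl /= add0r.
under eq_bigr => i _ do rewrite /bump /= add1n exprS.
rewrite -mulr_sumr [leRHS]mulrC; apply: ler_wpM2l => //.
exact: sum_geometric_le.
Qed.

End UnionBounds.

(** * Disconnection seen through separated node sets and split colour sets *)

Section Disconnection.

Local Open Scope ring_scope.

Variables (K : realFieldType) (n m k : nat).
Hypothesis km : (k <= m)%N.

Implicit Types (F : assignment n m) (A B U : {set 'I_m}) (S : {set 'I_n}).

Local Notation mean := (@rig_mean K n m k).

Lemma separatedC S F : separated (~: S) F = separated S F.
Proof.
wlog suff : S / separated S F -> separated (~: S) F.
  by move=> h; apply/idP/idP => [/h|/h //]; rewrite setCK.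
move=> /forallP h; apply/forallP => u; apply/implyP => uS.
apply/forallP => v; apply/implyP; rewrite setCK => vS; rewrite disjoint_sym.
by have /implyP/(_ vS)/forallP/(_ u)/implyP/(_ uS) := h v.
Qed.

(** The component of [u] is separated from its complement; whichever has at most [n/2] nodes is
    taken. *)
Lemma disconnected_separated F : ~~ rig_connected F ->
  exists S, [&& (0 < #|S|)%N, (#|S|.*2 <= n)%N & separated S F].
Proof.
move=> /forallPn[u /forallPn[v uv]].
pose S := [set w | connect (rig_adj F) u w].
have uS : u \in S by rewrite inE.
have vS : v \in ~: S by rewrite !inE.
have sepS : separated S F.
  apply/forallP => a; apply/implyP; rewrite inE => ua.
  apply/forallP => b; apply/implyP => bS; apply: contraTT bS => ab.
  rewrite !inE negbK; have [<-//|ba] := eqVneq a b.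
  by apply: connect_trans ua (connect1 _); rewrite /rig_adj ba setI_eq0.
have cS : (#|S| + #|~: S| = n)%N by rewrite cardsC card_ord.
have [h|h] := leqP #|S|.*2 n.
  by exists S; rewrite h sepS !andbT; apply/card_gt0P; exists u.
exists (~: S); rewrite separatedC sepS andbT; apply/andP; split; last first.
  by move: cS h; move: #|S| #|~: S| => a b; lia.
by apply/card_gt0P; exists v.
Qed.

Lemma mean_disconnected_nodes (rho : K) :
    0 <= rho <= 2^-1 ->
    (forall S, (0 < #|S|)%N -> (#|S|.*2 <= n)%N ->
      'C(n, #|S|)%:R * mean (fun F => (separated S F)%:R) <= rho ^+ #|S|) ->
  mean (fun F => (~~ rig_connected F)%:R) <= 2 * rho.
Proof.
move=> rho01 hS; have := sum_small_subsets_le rho01 hS.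
apply: le_trans; rewrite -rig_mean_sum; apply: le_rig_mean => // F _.
have [conF|disF] := boolP (rig_connected F); first exact: sumr_ge0.
have [S /and3P[S0 S2 sepS]] := disconnected_separated disF.
rewrite (bigD1 S) /=; last by rewrite S0.
by rewrite sepS lerDl; apply: sumr_ge0.
Qed.

Definition splits A F : bool := [forall v, (F v \subset A) || (F v \subset ~: A)].

(** [A] is the colour set of a separated [S], or its complement if that is smaller. Both are
    nonempty because each side contains a node and each node has a colour. *)
Lemma disconnected_splits F : (0 < k)%N -> valid_assignment k F ->
  ~~ rig_connected F -> exists A, [&& (0 < #|A|)%N, (#|A|.*2 <= m)%N & splits A F].
Proof.
move=> k0 /forallP vF disF.
have [S /and3P[S0 S2 sepS]] := disconnected_separated disF.
have F0 v : (0 < #|F v|)%N by rewrite (eqP (vF v)).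
have [u uS] := card_gt0P S0.
have [v vS] : exists v, v \in ~: S.
  by apply/card_gt0P; have := cardsC S; rewrite card_ord; lia.
pose A := colours F S.
have inA w : w \in S -> F w \subset A by exact: bigcup_sup.
have outA w : w \in ~: S -> F w \subset ~: A.
  move=> wS; rewrite -disjoints_subset.
  by move: sepS; rewrite separatedE => /allP; apply; rewrite mem_enum.
have splA : splits A F.
  apply/forallP => w; have [/inA->//|wS] := boolP (w \in S).
  by rewrite (outA w) ?orbT // inE.
have splCA : splits (~: A) F.
  by apply/forallP => w; rewrite setCK orbC; move/forallP: splA.
have A0 : (0 < #|A|)%N := leq_trans (F0 u) (subset_leq_card (inA u uS)).
have cA0 : (0 < #|~: A|)%N := leq_trans (F0 v) (subset_leq_card (outA v vS)).
have [h|h] := leqP #|A|.*2 m; first by exists A; rewrite A0 h.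
exists (~: A); rewrite cA0 splCA andbT /=.
by move: (cardsC A) h; rewrite card_ord; move: #|A| #|~: A| => a b; lia.
Qed.

Lemma mean_splits_le A : (2 <= k)%N -> (#|A|.*2 <= m)%N ->
  mean (fun F => (splits A F)%:R) <= (1 - #|A|%:R / m%:R) ^+ n.
Proof.
move=> k2 A2; have m0 : (0 < m)%N by lia.
have Am : (#|A| <= m)%N by lia.
pose Q A' := (A' \subset A) || (A' \subset ~: A).
have -> : mean (fun F => (splits A F)%:R) =
    mean (fun F => 1 * (all (fun v => Q (F v)) (enum 'I_n))%:R).
  apply: eq_rig_mean => F _; rewrite mul1r; congr (nat_of_bool _)%:R.
  by apply/forallP/allP => [h v _|h v]; [exact: h|apply: h; rewrite mem_enum].
rewrite (rig_mean_prod km (g := fun=> tt) (fun=> Q) (fun=> 1)) ?enum_uniq //.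
rewrite rig_meanZ rig_mean_cst // mul1r size_enum_ord.
set x := #|A|%:R / m%:R.
have x2 : 0 <= x <= 2^-1.
  rewrite divr_ge0 //= ler_pdivrMr ?ltr0n // mulrC ler_pdivlMr //.
  by rewrite -natrM ler_nat muln2.
apply: lerXn2r; rewrite ?nnegrE; [|lra|].
  by rewrite divr_ge0 // sumr_ge0.
(* With [k >= 2] and [x <= 1/2], [x^k + (1 - x)^k <= x^2 + (1 - x)^2 = 1 - 2x + 2x^2 <= 1 - x]. *)
apply: le_trans (_ : x ^+ k + (1 - x) ^+ k <= _); last first.
  have xk z : 0 <= z <= 1 -> z ^+ k <= z ^+ 2 :> K.
    by move=> /andP[z0 z1]; apply: ler_wiXn2l.
  have := xk x ltac:(lra); have := xk (1 - x) ltac:(lra); nra.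
apply: le_trans (_ : set_mean k (fun A' => (A' \subset A)%:R)
  + set_mean k (fun A' => (A' \subset ~: A)%:R) <= _).
  rewrite -set_meanD; apply: le_set_mean => // A' _.
  by rewrite /Q; case: (_ \subset _); case: (_ \subset _); rewrite /= ?addr0 ?add0r; lra.
rewrite !set_mean_subset // lerD //; first exact: bin_ratio_le.
have -> : #|~: A| = (m - #|A|)%N by rewrite cardsCs setCK card_ord.
have := bin_ratio_le K (leq_subr #|A| m) km; congr (_ <= _ ^+ _).
by rewrite natrB // mulrBl divff // pnatr_eq0 -lt0n.
Qed.

Lemma mean_disconnected_colours (rho : K) : (2 <= k)%N -> 0 <= rho <= 2^-1 ->
    (forall a, (0 < a)%N -> (a.*2 <= m)%N ->
      'C(m, a)%:R * (1 - a%:R / m%:R) ^+ n <= rho ^+ a) ->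
  mean (fun F => (~~ rig_connected F)%:R) <= 2 * rho.
Proof.
move=> k2 rho01 hA.
have hA' A : (0 < #|A|)%N -> (#|A|.*2 <= m)%N ->
    'C(m, #|A|)%:R * mean (fun F => (splits A F)%:R) <= rho ^+ #|A|.
  move=> A0 A2; apply: le_trans (hA _ A0 A2).
  by rewrite ler_wpM2l // mean_splits_le.
have := sum_small_subsets_le rho01 hA'.
apply: le_trans; rewrite -rig_mean_sum.
apply: le_rig_mean => // F vF.
have [conF|disF] := boolP (rig_connected F); first exact: sumr_ge0.
have [A /and3P[A0 A2 splA]] := disconnected_splits (ltnW k2) vF disF.
rewrite (bigD1 A) /=; last by rewrite A0.
by rewrite splA lerDl; apply: sumr_ge0.
Qed.

End Disconnection.

(** * Isolated nodes and their second moment *)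

Lemma bin_sub_bound m k j :
  ('C(m, k.+1) <= 'C(m - j, k.+1) + j * 'C(m.-1, k))%N.
Proof.
(* By Pascal's rule each further removed colour loses at most [C(m - 1, k)] subsets. *)
elim: j => [|j IH]; first by rewrite subn0 leq_addr.
apply: leq_trans IH _; rewrite mulSn addnA leq_add2r subnS.
have [->|h] := posnP (m - j)%N; first by rewrite leq_addr.
rewrite -{1}(prednK h) binS leq_add2l.
by apply: leq_bin2l; lia.
Qed.

Section IsolatedNodes.

Local Open Scope ring_scope.

Variables (K : realFieldType) (n m k : nat).
Hypothesis km : (k <= m)%N.

Implicit Types (F : assignment n m) (A B U : {set 'I_m}).

Local Notation mean := (@rig_mean K n m k).

Definition isolated F v : bool := [forall w, (w != v) ==> [disjoint F w & F v]].

Definition disjoint_prob : K := 'C(m - k, k)%:R / 'C(m, k)%:R.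

Local Notation q := disjoint_prob.

Lemma connected_not_isolated F v : (2 <= n)%N -> rig_connected F -> ~~ isolated F v.
Proof.
move=> n2 /forallP/(_ v)/forallP con; apply/negP => /forallP iso.
have [w] : exists w, w \in [set~ v].
  by apply/card_gt0P; rewrite cardsC1 card_ord; lia.
rewrite !inE => wv; have /connectP[[|x p] /=] := con w.
  by move=> _ wE; rewrite wE eqxx in wv.
move=> /andP[/andP[vx]] + _ _; rewrite setI_eq0 disjoint_sym.
by have := iso x; rewrite eq_sym vx /= => ->.
Qed.

Lemma disjoint_prob_ge0 : 0 <= q.
Proof. exact: divr_ge0. Qed.

(** At most [k C(m - 1, k - 1)] of the [k]-subsets meet a fixed [k]-set, and
    [C(m - 1, k - 1) / C(m, k) = k / m]. *)
Lemma disjoint_prob_ge : (0 < k)%N -> 1 - (k ^ 2)%:R / m%:R <= q.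
Proof.
move=> k0; have m0 : (0 < m)%N by lia.
have C0 : 0 < 'C(m, k)%:R :> K by rewrite ltr0n bin_gt0.
have mR : 0 < m%:R :> K by rewrite ltr0n.
rewrite ler_pdivlMr // mulrBl mul1r lerBlDr mulrAC.
rewrite -lerBlDl ler_pdivlMr // mulrBl lerBlDl -!natrM -natrD ler_nat.
have := leq_mul (bin_sub_bound m k.-1 k) (leqnn m).
rewrite (prednK k0) mulnDl => /leq_trans; apply.
rewrite leq_add2l -mulnA [X in (k * X)%N]mulnC mul_bin_diag (prednK k0).
by rewrite mulnA.
Qed.

Lemma disjoint_prob_double :
  'C(m - k.*2, k)%:R / 'C(m, k)%:R <= q ^+ 2.
Proof.
have C0 : 0 < 'C(m, k)%:R :> K by rewrite ltr0n bin_gt0.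
rewrite /disjoint_prob expr_div_n ler_pdivrMr // mulrAC ler_pdivlMr ?exprn_gt0 //.
rewrite [_ ^+ 2 in leLHS]expr2 mulrA ler_pM2r // -natrX -natrM ler_nat.
have fk : (0 < k`! ^ 2)%N by rewrite expn_gt0 fact_gt0.
rewrite -(leq_pmul2r fk) -expnMn bin_ffact -mulnn.
rewrite mulnACA !bin_ffact -mulnn !ffact_prod -!big_split /=.
(* Factor by factor, [(m - 2k - i)(m - i) <= (m - k - i)^2]. *)
apply: leq_prod => i _; nia.
Qed.

Lemma mean_isolated v : mean (fun F => (isolated F v)%:R) = q ^+ n.-1.
Proof.
under eq_rig_mean => F _ .
  rewrite -[_%:R]mul1r (_ : isolated F v =
    all (fun w => [disjoint F w & F v]) (enum [set~ v])); last first.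
    apply/forallP/allP => [h w|h w]; last first.
      by apply/implyP => wv; apply: h; rewrite mem_enum !inE.
    by rewrite mem_enum !inE => wv; have := h w; rewrite wv.
  over.
rewrite (rig_mean_prod km (g := fun F => F v) (fun B A => [disjoint A & B]) (fun=> 1))
  ?enum_uniq //; last first.
  by move=> w; rewrite mem_enum !inE => wv F A; rewrite update_other // eq_sym.
rewrite -[RHS](rig_mean_cst n km); apply: eq_rig_mean => F /forallP/(_ v)/eqP cF.
by rewrite mul1r set_mean_disjoint // cF -cardE cardsC1 card_ord.
Qed.

Lemma mean_disjoint_pair u v : u != v ->
  mean (fun F => [disjoint F v & F u]%:R) = q.
Proof.
move=> uv; under eq_rig_mean => F _.
  rewrite -[_%:R]mul1r (_ : [disjoint F v & F u] =
    all (fun w => [disjoint F w & F u]) [:: v]); last by rewrite /= andbT.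
  over.
rewrite (rig_mean_prod km (g := fun F => F u) (fun B A => [disjoint A & B]) (fun=> 1)) //;
  last first.
  by move=> w; rewrite inE => /eqP-> F A; rewrite update_other.
rewrite -[RHS](rig_mean_cst n km); apply: eq_rig_mean => F /forallP/(_ u)/eqP cF.
by rewrite mul1r set_mean_disjoint // cF expr1.
Qed.

(** If both are isolated, [F u] and [F v] are disjoint, which has probability [q], and each of the
    other [n - 2] nodes avoids their [2k] colours, which has probability at most [q^2] by
    [disjoint_prob_double]. *)
Lemma mean_isolated_pair u v : u != v ->
  mean (fun F => (isolated F u)%:R * (isolated F v)%:R) <= q * (q ^+ 2) ^+ (n - 2).
Proof.
move=> uv; pose r := enum (~: [set u; v]).
apply: le_trans (_ : mean (fun F => [disjoint F v & F u]%:R *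
   (all (fun w => [disjoint F w & F u :|: F v]) r)%:R) <= _).
  apply: le_rig_mean => // F _; rewrite -!natrM !mulnb ler_nat.
  have [/andP[/forallP iu /forallP iv]|//] := boolP (isolated F u && isolated F v).
  have := iu v; rewrite eq_sym uv /= => ->; rewrite lt0b /=.
  apply/allP => w; rewrite mem_enum !inE negb_or => /andP[wu wv].
  have := iu w; have := iv w; rewrite wu wv /= => dv du.
  by rewrite disjoint_sym -setI_eq0 setIUl !disjoint_setI0 ?setU0 // disjoint_sym.
rewrite (rig_mean_prod km (g := fun F => (F u, F v))
  (fun P A => [disjoint A & P.1 :|: P.2]) (fun P => [disjoint P.2 & P.1]%:R))
  ?enum_uniq //; last first.
  move=> w; rewrite mem_enum !inE negb_or => /andP[wu wv] F A.
  by rewrite !update_other // eq_sym.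
apply: le_trans (_ : mean (fun F => (q ^+ 2) ^+ (n - 2) * [disjoint F v & F u]%:R) <= _);
  last by rewrite rig_meanZ mean_disjoint_pair // mulrC.
apply: le_rig_mean => // F /forallP vF /=; rewrite mulrC.
have [duv|_] := boolP [disjoint F v & F u]; last by rewrite !mulr0.
rewrite !mulr1 -cardE [#|~: _|]cardsCs setCK card_ord cards2 uv.
apply: lerXn2r; rewrite ?nnegrE ?exprn_ge0 ?disjoint_prob_ge0 //.
  by rewrite divr_ge0 // sumr_ge0.
rewrite set_mean_disjoint // cardsU setIC (disjoint_setI0 duv) cards0 subn0.
by rewrite !(eqP (vF _)) addnn disjoint_prob_double.
Qed.

Lemma mean_connected_le : (2 <= n)%N -> 0 < q ->
  mean (fun F => (rig_connected F)%:R) <= (n%:R * q ^+ n.-1)^-1 + (q^-1 - 1).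
Proof.
move=> n2 q0; pose X F : K := \sum_v (isolated F v)%:R.
set mu := n%:R * q ^+ n.-1.
have mu0 : 0 < mu by rewrite mulr_gt0 ?exprn_gt0 // ltr0n; lia.
have EX : mean X = mu.
  rewrite rig_mean_sum (eq_bigr (fun=> q ^+ n.-1)) => [|v _]; last exact: mean_isolated.
  by rewrite sumr_const card_ord -[_ *+ _]mulr_natl.
(* The diagonal terms sum to [mu], as indicators are idempotent; the others total at most
   [n^2 q^(2n - 3) = mu^2 / q]. *)
have EX2 : mean (fun F => X F ^+ 2) <= mu + mu ^+ 2 / q.
  under eq_rig_mean => F _ do rewrite expr2 mulr_suml.
  rewrite rig_mean_sum.
  apply: le_trans (_ : \sum_(u < n) (q ^+ n.-1 + n%:R * (q * (q ^+ 2) ^+ (n - 2))) <= _).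
    apply: ler_sum => u _.
    under eq_rig_mean => F _ do rewrite mulr_sumr (bigD1 u) //=.
    rewrite rig_meanD lerD //.
      rewrite -(mean_isolated u); apply: le_rig_mean => // F _.
      by case: isolated; rewrite /= ?mulr1 ?mulr0.
    rewrite rig_mean_sum.
    apply: le_trans (_ : \sum_(v | v != u) q * (q ^+ 2) ^+ (n - 2) <= _).
      by apply: ler_sum => v vu; apply: mean_isolated_pair; rewrite eq_sym.
    rewrite sumr_const -[_ *+ _]mulr_natl ler_wpM2r //.
      by rewrite mulr_ge0 ?exprn_ge0 // ltW.
    by rewrite ler_nat -[leqRHS](card_ord n) max_card.
  rewrite sumr_const card_ord -[_ *+ _]mulr_natl mulrDr -/mu lerD2l.
  have e : (q ^+ 2) ^+ (n - 2) * q ^+ 2 = (q ^+ n.-1) ^+ 2.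
    by rewrite -exprSr -!exprM; congr (_ ^+ _); lia.
  rewrite ler_pdivlMr // /mu [leRHS]exprMn -e le_eqVlt; apply/orP; left; apply/eqP; ring.
have mu20 : 0 < mu ^+ 2 by rewrite exprn_gt0.
(* Chebyshev: a connected graph has [X = 0], where this quotient is [1]. *)
apply: le_trans (_ : mean (fun F => (X F - mu) ^+ 2 / mu ^+ 2) <= _).
  apply: le_rig_mean => // F _; rewrite ler_pdivlMr //.
  have [con|_] := boolP (rig_connected F); last by rewrite mul0r sqr_ge0.
  rewrite /X big1 ?sub0r ?sqrrN ?mul1r // => v _.
  by rewrite (negbTE (connected_not_isolated _ n2 con)).
under eq_rig_mean => F _ do rewrite mulrC.
rewrite rig_meanZ.
have -> : mean (fun F => (X F - mu) ^+ 2) = mean (fun F => X F ^+ 2) - mu ^+ 2.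
  transitivity (mean (fun F => X F ^+ 2 + ((- (2 * mu)) * X F + mu ^+ 2))).
    by apply: eq_rig_mean => F _; ring.
  by rewrite !rig_meanD rig_meanZ EX rig_mean_cst //; ring.
rewrite mulrC ler_pdivrMr //.
have -> : (mu^-1 + (q^-1 - 1)) * mu ^+ 2 = mu + mu ^+ 2 / q - mu ^+ 2.
  by field; rewrite !gt_eqF.
lra.
Qed.

End IsolatedNodes.

(** * Passage from means to [rig_prob] over the standard reals *)

Section Transfer.

Local Open Scope ring_scope.
Local Open Scope R_scope.

Variables (n m k : nat).

Implicit Types (E : pred (assignment n m)) (F : assignment n m).

Lemma rig_probE E : rig_prob k E = rig_mean k (fun F => (E F)%:R)%R.
Proof.
rewrite /rig_prob /rig_mean RdivE !INRE card_valid_assignment; congr (_ / _)%R.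
rewrite -natr_sum; congr (_%:R)%R.
rewrite -sum1_card [LHS]big_mkcond [RHS]big_mkcond; apply: eq_bigr => F _.
by rewrite inE; case: valid_assignment; case: (E F).
Qed.

Lemma rig_prob_ge0 E : 0 <= rig_prob k E.
Proof. by apply/RleP; rewrite rig_probE divr_ge0 // sumr_ge0. Qed.

Hypothesis km : (k <= m)%N.

Lemma rig_prob_compl E : rig_prob k E = 1 - rig_prob k (fun F => ~~ E F).
Proof.
rewrite !rig_probE RminusE; apply/eqP; rewrite eq_sym subr_eq -rig_meanD; apply/eqP.
rewrite -[LHS](rig_mean_cst n km); apply: eq_rig_mean => F _.
by case: (E F); rewrite /= ?addr0 ?add0r.
Qed.

(** Each size [s] may use its own bound: the exponential one with suitable [x] and [y], or the
    threshold one with a suitable [a]. *)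
Lemma rig_prob_disconnected_nodes (rho : R) :
    (0 < m)%N -> 0 <= rho <= / 2 ->
    (forall s, (0 < s)%N -> (s.*2 <= n)%N ->
      (exists x y : R,
        [/\ (1 - / INR m) ^ (k * (n - s)) <= y <= 1, 0 <= x <= 1,
            INR (k * s) <= x * INR m &
            INR 'C(n, s) * (y + (1 - y) * x) ^ (k * s) <= rho ^ s])
      \/ (exists2 a, (a <= m)%N &
            INR 'C(n, s) * (INR 'C(m, a) * (INR a / INR m) ^ (k * s)
              + (1 - INR a / INR m) ^ (k * (n - s))) <= rho ^ s)) ->
  rig_prob k (fun F => ~~ rig_connected F) <= 2 * rho.
Proof.
move=> m0 [/RleP r0 /RleP r1] H; apply/RleP.
rewrite rig_probE; apply: mean_disconnected_nodes => //; first by rewrite r0.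
move=> S S0 S2; have := H _ S0 S2; rewrite !RpowE.
case=> [[x [y []]]|[a am]] /=.
  rewrite !RpowE !INRE => -[/RleP yl /RleP yr] [/RleP x0 /RleP x1] /RleP hx /RleP.
  apply: le_trans; apply: ler_wpM2l => //.
  by apply: mean_separated_expr => //; rewrite ?yl ?x0.
rewrite !RpowE !INRE !RdivE => /RleP; apply: le_trans; apply: ler_wpM2l => //.
exact: mean_separated_threshold.
Qed.

Lemma rig_prob_disconnected_colours (rho : R) :
    (2 <= k)%N -> 0 <= rho <= / 2 ->
    (forall a, (0 < a)%N -> (a.*2 <= m)%N ->
      INR 'C(m, a) * (1 - INR a / INR m) ^ n <= rho ^ a) ->
  rig_prob k (fun F => ~~ rig_connected F) <= 2 * rho.
Proof.
move=> k2 [/RleP r0 /RleP r1] H; apply/RleP.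
rewrite rig_probE; apply: mean_disconnected_colours => //; first by rewrite r0.
by move=> a a0 a2; have /RleP := H _ a0 a2; rewrite !RpowE INRE RdivE !INRE.
Qed.

Lemma rig_prob_connected_le : (2 <= n)%N -> (0 < k)%N ->
  exists2 q : R, 1 - INR k ^ 2 / INR m <= q &
  (0 < q -> rig_prob k (fun F => rig_connected F)
    <= / (INR n * q ^ n.-1) + (/ q - 1)).
Proof.
move=> n2 k0; exists (disjoint_prob R m k).
  by apply/RleP; have := disjoint_prob_ge R km k0; rewrite natrX -!INRE -RpowE -RdivE.
move=> /RltP q0; apply/RleP; rewrite rig_probE INRE RpowE.
exact: mean_connected_le.
Qed.

End Transfer.

(** The left side is one term of the binomial expansion. *)
Lemma bin_mul_pow_le n s (t : R) : Rle 0 t ->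
  Rle (INR 'C(n, s) * t ^ s) ((1 + t) ^ n).
Proof.
move=> /RleP t0; apply/RleP; rewrite !RpowE INRE RmultE RplusE.
rewrite (exprDn 1%R t n).
have [sn|ns] := leqP s n; last first.
  rewrite bin_small // mulr0n mul0r; apply: sumr_ge0 => i _.
  by rewrite mulrn_wge0 // mulr_ge0 // exprn_ge0.
rewrite (bigD1 (Ordinal (sn : (s < n.+1)%N))) //= expr1n mul1r mulr_natl.
rewrite lerDl; apply: sumr_ge0 => i _.
by rewrite mulrn_wge0 // mulr_ge0 // exprn_ge0.
Qed.

End Counting.

Import Counting.

Local Open Scope R_scope.

(** * Elementary estimates for exponentials and binomial coefficients *)

Lemma INR_muln a b : INR (a * b)%nat = INR a * INR b.
Proof. by rewrite -multE mult_INR. Qed.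

Lemma INR_subn a b : (b <= a)%nat -> INR (a - b)%nat = INR a - INR b.
Proof. by move=> /leP ba; rewrite -minusE minus_INR. Qed.

Lemma le_INR_nat a b : (a <= b)%nat -> INR a <= INR b.
Proof. by move=> /leP; apply: le_INR. Qed.

Lemma INR_gt0 a : (0 < a)%nat -> 0 < INR a.
Proof. by move=> /ltP; apply: lt_0_INR. Qed.

Lemma Rle_divr a b c : 0 < c -> a * c <= b -> a <= b / c.
Proof. by move=> c0 /Rle_div_r; apply. Qed.

Lemma Rdiv_lel a b c : 0 < c -> a <= b * c -> a / c <= b.
Proof. by move=> c0 /Rle_div_l; apply. Qed.

Lemma Rdiv_le_mul a b c : 0 < c -> a / c <= b -> a <= b * c.
Proof. by move=> c0 h; apply/Rle_div_l. Qed.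

Lemma Rle_div_mul a b c : 0 < c -> a <= b / c -> a * c <= b.
Proof. by move=> c0 h; apply/Rle_div_r. Qed.

Lemma exp_pow a n : exp a ^ n = exp (INR n * a).
Proof.
elim: n => [|n IH]; first by rewrite Rmult_0_l exp_0.
by rewrite -tech_pow_Rmult IH -exp_plus S_INR; congr exp; ring.
Qed.

Lemma exp_le a b : a <= b -> exp a <= exp b.
Proof. by case=> [/exp_increasing/Rlt_le|->] //; apply: Rle_refl. Qed.

Lemma exp_ge1D x : 1 + x <= exp x.
Proof.
have [->|x0] := Req_dec x 0; first by rewrite exp_0; lra.
by have := exp_ineq1 x x0; lra.
Qed.

Lemma pow_le_exp b c n : 0 <= b -> b <= exp c -> b ^ n <= exp (INR n * c).
Proof. by move=> b0 bc; rewrite -exp_pow; apply: pow_incr. Qed.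

Lemma pow_1B_le_exp z n : z <= 1 -> (1 - z) ^ n <= exp (- (INR n * z)).
Proof.
move=> z1; have -> : - (INR n * z) = INR n * - z by ring.
by apply: pow_le_exp; [lra | have := exp_ge1D (- z); lra].
Qed.

(** [C(n, s) e^(s c) <= (1 + e^c)^n <= exp (n e^c)]. The free parameter [c] is tuned to the size of
    [s]; the values [0], [- ln n], [ln delta] and [ln (s/m)] are used below. *)
Lemma bin_le_exp n s c :
  INR 'C(n, s) <= exp (INR n * exp c - INR s * c).
Proof.
have t0 := exp_pos c.
have h : INR 'C(n, s) * exp (INR s * c) <= exp (INR n * exp c).
  rewrite -exp_pow; apply: Rle_trans (bin_mul_pow_le n s (Rlt_le _ _ t0)) _.
  by apply: pow_le_exp; [lra | exact: exp_ge1D].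
have p := exp_pos (- (INR s * c)).
have := Rmult_le_compat_r _ _ _ (Rlt_le _ _ p) h.
rewrite Rmult_assoc -!exp_plus.
have -> : INR s * c + - (INR s * c) = 0 by ring.
by rewrite exp_0 Rmult_1_r.
Qed.

Lemma bin_le_exp_self n s : INR 'C(n, s) <= exp (INR n).
Proof. by have := bin_le_exp n s 0; rewrite exp_0 Rmult_1_r Rmult_0_r Rminus_0_r. Qed.

Lemma bin_le_exp_ln n s : (0 < n)%nat -> INR 'C(n, s) <= exp (1 + INR s * ln (INR n)).
Proof.
move=> n0; have n1 := INR_gt0 n0; have := bin_le_exp n s (- ln (INR n)).
rewrite exp_Ropp exp_ln // Rinv_r; last by lra.
by have -> : 1 - INR s * - ln (INR n) = 1 + INR s * ln (INR n) by ring.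
Qed.

Lemma colour_term_le n m a : (0 < a)%nat -> (a <= m)%nat ->
  INR 'C(m, a) * (1 - INR a / INR m) ^ n
  <= exp (1 + ln (INR m) - INR n / INR m) ^ a.
Proof.
move=> a0 am; have m0 : (0 < m)%nat by lia.
have mR := INR_gt0 m0; have aR := le_INR_nat am; have a1 := le_INR_nat a0.
have am1 : INR a / INR m <= 1 by apply: Rdiv_lel; lra.
apply: Rle_trans (_ : exp (1 + INR a * ln (INR m)) * exp (- (INR n * (INR a / INR m))) <= _).
  apply: Rmult_le_compat; [exact: pos_INR | apply: pow_le; lra | |].
    exact: bin_le_exp_ln.
  exact: pow_1B_le_exp.
rewrite -exp_plus exp_pow; apply: exp_le; rewrite /= in a1.
have -> : INR n * (INR a / INR m) = INR a * (INR n / INR m) by field; lra.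
nra.
Qed.

(** * Three regimes for the size of a separated node set *)

Section NodeRegimes.

Variables (eps r delta : R) (n m k s : nat).
Hypotheses (eps01 : 0 < eps <= 1) (r1 : 1 <= r) (delta8 : delta = eps / 8).
Hypotheses (nm : (n <= m)%nat) (k2 : (2 <= k)%nat).
Hypotheses (s0 : (0 < s)%nat) (s2 : (s.*2 <= n)%nat).
Hypothesis kn : (1 + eps) * (INR m * ln (INR n)) <= INR k ^ 2 * INR n.

(** [exp (- w)] dominates [(1 - 1/m)^(k (n - s))] and serves as [y]. [D] is chosen so that
    [delta y < x] gives [y + (1 - y) x <= D x]. *)
Let w := INR k * (INR n - INR s) / INR m.
Let x := INR k * INR s / INR m.
Let D := 1 + / delta.

Let sR : 1 <= INR s. Proof. exact: (le_INR_nat s0). Qed.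
Let nR : 2 * INR s <= INR n.
Proof. by have := le_INR_nat s2; rewrite -muln2 INR_muln /=; lra. Qed.
Let mR : INR n <= INR m. Proof. exact: le_INR_nat. Qed.
Let kR : 2 <= INR k. Proof. exact: (le_INR_nat k2). Qed.
Let w0 : 0 <= w.
Proof. by apply: Rdiv_le_0_compat; [apply: Rmult_le_pos|]; lra. Qed.
Let x0 : 0 < x.
Proof. by apply: Rdiv_lt_0_compat; [apply: Rmult_lt_0_compat|]; lra. Qed.
Let delta0 : 0 < delta. Proof. rewrite delta8; lra. Qed.

Let kw : INR k * w = (INR k ^ 2 * INR n / INR m) * (1 - INR s / INR n).
Proof. by rewrite /w; field; lra. Qed.

Let T_ge : (1 + eps) * ln (INR n) <= INR k ^ 2 * INR n / INR m.
Proof. by apply: Rle_divr; [lra | have := kn; nra]. Qed.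

Let L0 : 0 <= ln (INR n).
Proof. by rewrite -ln_1; apply: ln_le; lra. Qed.

(** Here [y + (1 - y) x <= y (1 + delta (1 - y)) <= exp (- (1 - delta) w)], so each node of [S]
    gains a factor [exp (- (1 - delta) k w)] against [C(n, s)]. *)
Lemma node_term_sparse : x <= delta * exp (- w) ->
    2 * (1 + r) <= eps * ln (INR n) -> 4 * (1 + r - ln delta) <= ln (INR n) ->
  INR 'C(n, s) * (exp (- w) + (1 - exp (- w)) * x) ^ (k * s) <= exp (- r) ^ s.
Proof.
move=> hx hL1 hL2; set y := exp (- w) in hx *.
have y0 : 0 < y := exp_pos _.
have y1 : y <= 1 by rewrite /y -exp_0; apply: exp_le; lra.
have yw : 1 - y <= w by have := exp_ge1D (- w); rewrite -/y; lra.
have hb : y + (1 - y) * x <= exp (- ((1 - delta) * w)).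
  have -> : - ((1 - delta) * w) = - w + delta * w by ring.
  rewrite exp_plus -/y.
  have := exp_ge1D (delta * w); have : delta * (1 - y) <= delta * w by nra.
  nra.
have := pow_le_exp (k * s) _ hb; rewrite INR_muln => /(_ ltac:(nra)) hp.
rewrite exp_pow.
have sn : 0 <= INR s / INR n by apply: Rdiv_le_0_compat; lra.
(* For [s <= delta n] the gain per node beats the [ln n] in [C(n, s) <= exp (1 + s ln n)]. For
   larger [s], [C(n, s) <= exp (s (1 - ln delta))], and a gain of [ln n / 4] per node is enough. *)
have [hs|hs] := Rle_lt_dec (INR s) (delta * INR n).
- have sn1 : INR s / INR n <= delta by apply: Rdiv_lel; lra.
  apply: Rle_trans (Rmult_le_compat _ _ _ _ _ _ (bin_le_exp_ln s _) hp) _;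
    [exact: pos_INR | apply: pow_le; nra | lia |].
  rewrite -exp_plus; apply: exp_le.
  have -> : INR k * INR s * - ((1 - delta) * w) = - (INR s * ((1 - delta) * (INR k * w))).
    by ring.
  have kw1 : (1 + eps / 2) * ln (INR n) <= (1 - delta) * (INR k * w).
    rewrite kw; move: T_ge; set T := INR k ^ 2 * INR n / INR m => hT.
    apply: Rle_trans (_ : (1 - delta) * ((1 + eps) * ln (INR n) * (1 - delta)) <= _).
      (* [(1 - delta)^2 >= 1 - eps/4], and [(1 - eps/4)(1 + eps) >= 1 + eps/2] because
         [eps <= 1]. *)
      have : 1 + eps / 2 <= (1 - delta) * (1 + eps) * (1 - delta).
        by rewrite delta8; nra.
      nra.
    apply: Rmult_le_compat_l; first by rewrite delta8; lra.
    by apply: Rmult_le_compat; rewrite ?delta8; (lra || nra).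
  nra.
- have := bin_le_exp n s (ln delta); rewrite exp_ln // => hC.
  apply: Rle_trans (Rmult_le_compat _ _ _ _ _ _ hC hp) _;
    [exact: pos_INR | apply: pow_le; nra |].
  rewrite -exp_plus; apply: exp_le.
  have -> : INR k * INR s * - ((1 - delta) * w) = - (INR s * ((1 - delta) * (INR k * w))).
    by ring.
  have sn2 : INR s / INR n <= / 2 by apply: Rdiv_lel; lra.
  have kw1 : ln (INR n) / 4 <= (1 - delta) * (INR k * w).
    rewrite kw; move: T_ge; set T := INR k ^ 2 * INR n / INR m => hT.
    have T1 : ln (INR n) <= T by nra.
    apply: Rle_trans (_ : / 2 * (ln (INR n) * / 2) <= _); first by lra.
    by apply: Rmult_le_compat; rewrite ?delta8; (lra || nra).
  nra.
Qed.

(** As [n <= m], [c = ln (s/m)] gives [C(n, s) <= exp (s (1 - ln (s/m)))], where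
    [s/m = D x / (D k)]. The exponent per node is then at most [1 + ln D + ln k + (k - 1) ln (D x)];
    [ln (D x) <= -2] and [ln k <= k] reduce it to [3 + ln D - k <= - r]. *)
Lemma node_term_middle : delta * exp (- w) < x -> D * x <= exp (- 2) ->
    3 + ln D + r <= INR k ->
  INR 'C(n, s) * (exp (- w) + (1 - exp (- w)) * x) ^ (k * s) <= exp (- r) ^ s.
Proof.
move=> hx hD hk; set y := exp (- w) in hx *.
have y0 : 0 < y := exp_pos _.
have y1 : y <= 1 by rewrite /y -exp_0; apply: exp_le; lra.
have D1 : 0 < / delta by apply: Rinv_0_lt_compat.
have D0 : 0 < D by rewrite /D; lra.
have hb : y + (1 - y) * x <= D * x.
  have : y <= / delta * x.
    have -> : y = / delta * (delta * y) by field; lra.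
    by apply: Rmult_le_compat_l; lra.
  by rewrite /D; nra.
have Dx : 0 < D * x by nra.
have lsm : exp (ln (INR s / INR m)) = INR s / INR m.
  by apply: exp_ln; apply: Rdiv_lt_0_compat; lra.
have hC := bin_le_exp n s (ln (INR s / INR m)); rewrite lsm in hC.
have hns : INR n * (INR s / INR m) <= INR s.
  have -> : INR n * (INR s / INR m) = INR s * (INR n / INR m) by field; lra.
  have : INR n / INR m <= 1 by apply: Rdiv_lel; lra.
  nra.
have {}hb : (y + (1 - y) * x) ^ (k * s) <= exp (INR k * INR s * ln (D * x)).
  by rewrite -INR_muln; apply: pow_le_exp; [nra | rewrite exp_ln].
apply: Rle_trans (Rmult_le_compat _ _ _ _ _ _ hC hb) _;
  [exact: pos_INR | apply: pow_le; nra |].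
rewrite -exp_plus exp_pow; apply: exp_le.
have lx : ln (INR s / INR m) = ln (D * x) - ln D - ln (INR k).
  have e : INR s / INR m = D * x / D / INR k by rewrite /x; field; lra.
  rewrite e !ln_div //; try lra; apply: Rdiv_lt_0_compat; lra.
have lk : ln (INR k) <= INR k.
  have := exp_ge1D (ln (INR k)); rewrite exp_ln; lra.
have lD : ln (D * x) <= - 2.
  by rewrite -(ln_exp (- 2)); apply: ln_le.
rewrite lx.
have : (INR k - 1) * ln (D * x) <= (INR k - 1) * - 2 by nra.
nra.
Qed.

(** Now [m <= k s D e^2], and [ln theta] is chosen to make [theta^(k s) <= exp (- (r + 3) m)], which
    absorbs [C(m, a) <= e^m]. The other term is small because [n - s >= n/2] and [a/m >= theta/2].
    Both are at most [exp (- (r + 2) n)], leaving [e^(2n)] to cover [C(n, s)] and the factor [2]. *)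
Lemma node_term_dense theta :
    0 < theta < 1 -> exp (- 2) < D * x ->
    ln theta = - ((r + 3) * (D * exp 2)) ->
    2 <= theta * INR m -> 4 * (r + 2) <= theta * INR k ->
  exists2 a, (a <= m)%nat &
  INR 'C(n, s) * (INR 'C(m, a) * (INR a / INR m) ^ (k * s)
     + (1 - INR a / INR m) ^ (k * (n - s))) <= exp (- r) ^ s.
Proof.
move=> th01 hD lth thm thk.
have D1 : 0 < / delta by apply: Rinv_0_lt_compat.
have D0 : 0 < D by rewrite /D; lra.
have [a [ha1 ha2]] := nfloor_ex (theta * INR m) ltac:(lra).
have am : (a <= m)%nat by apply/leP/INR_le; nra.
exists a => //.
have am0 : 0 <= INR a / INR m by apply: Rdiv_le_0_compat; [exact: pos_INR | lra].
have amt : INR a / INR m <= theta by apply: Rdiv_lel; lra.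
(* Rounding [theta m >= 2] down loses at most half of it. *)
have amg : theta / 2 <= INR a / INR m by apply: Rle_divr; lra.
have h1 : (INR a / INR m) ^ (k * s) <= exp (INR k * INR s * ln theta).
  by rewrite -INR_muln; apply: pow_le_exp => //; rewrite exp_ln; lra.
have h2 : (1 - INR a / INR m) ^ (k * (n - s)) <= exp (- ((r + 2) * INR n)).
  apply: Rle_trans (pow_1B_le_exp _ _) _; first by lra.
  apply: exp_le; apply: Ropp_le_contravar; rewrite INR_muln INR_subn; last by lia.
  apply: Rle_trans (_ : INR k * (INR n / 2) * (theta / 2) <= _); first by nra.
  by apply: Rmult_le_compat => //; nra.
have h3 : INR 'C(m, a) * (INR a / INR m) ^ (k * s) <= exp (- ((r + 2) * INR n)).
  apply: Rle_trans (Rmult_le_compat _ _ _ _ _ _ (bin_le_exp_self m a) h1) _;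
    [exact: pos_INR | exact: pow_le |].
  rewrite -exp_plus; apply: exp_le; rewrite lth.
  have ks : INR m <= INR k * INR s * (D * exp 2).
    have -> : INR k * INR s * (D * exp 2) = D * x * exp 2 * INR m by rewrite /x; field; lra.
    have : 1 <= D * x * exp 2.
      have -> : 1 = exp (- 2) * exp 2 by rewrite -exp_plus -exp_0; congr exp; ring.
      by apply: Rmult_le_compat_r; [apply/Rlt_le/exp_pos | lra].
    nra.
  nra.
apply: Rle_trans (_ : exp (INR n) * (2 * exp (- ((r + 2) * INR n))) <= _).
  apply: Rmult_le_compat; [exact: pos_INR | | exact: bin_le_exp_self | lra].
  apply: Rplus_le_le_0_compat; last by apply: pow_le; lra.
  by apply: Rmult_le_pos; [exact: pos_INR | exact: pow_le].
have e1 : 2 <= exp (INR n) by have := exp_ge1D (INR n); lra.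
apply: Rle_trans (_ : exp (INR n) * (exp (INR n) * exp (- ((r + 2) * INR n))) <= _).
  apply: Rmult_le_compat_l; first exact/Rlt_le/exp_pos.
  by apply: Rmult_le_compat_r => //; apply/Rlt_le/exp_pos.
by rewrite -!exp_plus exp_pow; apply: exp_le; nra.
Qed.

End NodeRegimes.

(** * Explicit thresholds on [ln n] *)

Lemma Rmax_le_and a b c : Rmax a b <= c -> a <= c /\ b <= c.
Proof. by have := Rmax_l a b; have := Rmax_r a b; lra. Qed.

Lemma exp_ge_self u : u <= exp u.
Proof. by have := exp_ge1D u; lra. Qed.

Lemma exp_ge_sqr u : 0 <= u -> u ^ 2 / 4 <= exp u.
Proof.
move=> u0; have -> : u = u / 2 + u / 2 by field.
by rewrite exp_plus; have := exp_ge1D (u / 2); nra.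
Qed.

Lemma exp_opp_le_half r : 1 <= r -> exp (- r) <= / 2.
Proof.
move=> r1; rewrite exp_Ropp; apply: Rinv_le_contravar; first by lra.
by have := exp_ge1D r; lra.
Qed.

Lemma disconnected_nodes_small eps r : 0 < eps <= 1 -> 1 <= r ->
  exists L0, forall n m k : nat, (n <= m)%nat -> (2 <= k)%nat -> (k <= m)%nat ->
    (1 + eps) * (INR m * ln (INR n)) <= INR k ^ 2 * INR n -> L0 <= ln (INR n) ->
    rig_prob k (fun F : assignment n m => ~~ rig_connected F) <= 2 * exp (- r).
Proof.
move=> eps01 r1; pose delta := eps / 8; pose D := 1 + / delta.
pose theta := exp (- ((r + 3) * (D * exp 2))).
have d0 : 0 < delta by rewrite /delta; lra.
have D1 : 1 < D by rewrite /D; have := Rinv_0_lt_compat _ d0; lra.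
have th01 : 0 < theta < 1.
  split; first exact: exp_pos.
  rewrite -exp_0; apply: exp_increasing; have e2 := exp_pos 2.
  have : 0 < (r + 3) * (D * exp 2) by apply: Rmult_lt_0_compat; [lra | nra].
  lra.
pose K0 := Rmax (3 + ln D + r) (4 * (r + 2) / theta).
exists (Rmax (Rmax (2 * (1 + r) / eps) (4 * (1 + r - ln delta))) (Rmax (K0 ^ 2) (2 / theta))).
move=> n m k nm k2 km kn /Rmax_le_and[/Rmax_le_and[hL1 hL2] /Rmax_le_and[hL3 hL4]].
apply: rig_prob_disconnected_nodes => //; first by lia.
  by split; [exact/Rlt_le/exp_pos | exact: exp_opp_le_half].
move=> s s0 s2.
have nR : 1 <= INR n by apply: (@le_INR_nat 1); lia.
have mR := le_INR_nat nm.
have sR : 1 <= INR s := le_INR_nat s0.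
have ns : INR s <= INR n by apply: le_INR_nat; lia.
have kR : 2 <= INR k := le_INR_nat k2.
(* The density hypothesis and [n <= m] give [ln n <= k^2], so [k] exceeds the constant [K0]. *)
have kK : K0 <= INR k.
  have : K0 ^ 2 <= INR k ^ 2.
    apply: Rle_trans hL3 _; set L := ln (INR n) in hL2 kn *.
    have L0 : 0 <= L by rewrite /L -ln_1; apply: ln_le; lra.
    have h : INR n * L <= INR k ^ 2 * INR n.
      apply: Rle_trans kn; have : INR n * L <= INR m * L by nra.
      have : 0 <= INR m * L by nra.
      nra.
    apply: (Rmult_le_reg_l (INR n)); lra.
  nra.
have {kK} [kK1 kK2] : 3 + ln D + r <= INR k /\ 4 * (r + 2) <= theta * INR k.
  move: kK => /Rmax_le_and[h1 h2]; split=> //.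
  by rewrite (Rmult_comm theta); apply: Rdiv_le_mul h2; lra.
have c1 : 2 * (1 + r) <= eps * ln (INR n).
  by rewrite (Rmult_comm eps); apply: Rdiv_le_mul hL1; lra.
have c5 : 2 <= theta * INR m.
  rewrite (Rmult_comm theta); apply: Rdiv_le_mul; first by lra.
  apply: Rle_trans hL4 _; apply: Rle_trans mR.
  by have := exp_ge_self (ln (INR n)); rewrite exp_ln; lra.
set x := INR k * INR s / INR m; set w := INR k * (INR n - INR s) / INR m.
have x0 : 0 <= x by apply: Rdiv_le_0_compat; nra.
have w0 : 0 <= w by apply: Rdiv_le_0_compat; nra.
have y1 : exp (- w) <= 1 by rewrite -exp_0; apply: exp_le; lra.
have yw : (1 - / INR m) ^ (k * (n - s)) <= exp (- w).
  apply: Rle_trans (pow_1B_le_exp _ _) _.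
    by rewrite -Rinv_1; apply: Rinv_le_contravar; lra.
  apply: exp_le; rewrite INR_muln INR_subn; last by lia.
  by apply: Req_le; rewrite /w; field; lra.
have xm : INR (k * s) <= x * INR m.
  by rewrite INR_muln; apply: Req_le; rewrite /x; field; lra.
have [hD|hD] := Rle_lt_dec (D * x) (exp (- 2)); last first.
  right; apply: (node_term_dense eps01 r1 (erefl delta) nm k2 s0 s2 th01 hD _ c5 kK2).
  exact: ln_exp.
left; exists x, (exp (- w)).
have x1 : x <= 1.
  have : exp (- 2) <= 1 by rewrite -exp_0; apply: exp_le; lra.
  nra.
split=> //.
have [hx|hx] := Rle_lt_dec x (delta * exp (- w)).
  exact: (node_term_sparse eps01 r1 (erefl delta) nm k2 s0 s2 kn hx c1 hL2).
exact: (node_term_middle eps01 (erefl delta) nm k2 s0 s2 hx hD kK1).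
Qed.

(** For [alpha < 1], [n/m >= n^(1 - alpha)] outgrows [ln m], so in [colour_term_le] each colour of
    [A] contributes at most [exp (- r)]. *)
Lemma disconnected_colours_small alpha r : 0 < alpha < 1 -> 1 <= r ->
  exists L0, forall n m k : nat, (0 < n)%nat -> (2 <= k)%nat -> (k <= m)%nat ->
    INR m <= Rpower (INR n) alpha -> L0 <= ln (INR n) ->
    rig_prob k (fun F : assignment n m => ~~ rig_connected F) <= 2 * exp (- r).
Proof.
move=> al01 r1; pose c := 1 - alpha.
exists (Rmax 1 (4 * (2 + r) / c ^ 2)) => n m k n0 k2 km mn /Rmax_le_and[hL1 hL2].
have c0 : 0 < c by rewrite /c; lra.
apply: rig_prob_disconnected_colours => //.
  by split; [exact/Rlt_le/exp_pos | exact: exp_opp_le_half].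
move=> a a0 a2; apply: Rle_trans (colour_term_le n a0 _) _; first by lia.
apply: pow_incr; split; first exact/Rlt_le/exp_pos.
apply: exp_le; have nR := INR_gt0 n0.
have mR : 0 < INR m by apply: INR_gt0; lia.
set L := ln (INR n) in hL1 hL2 *.
have lm : ln (INR m) <= alpha * L.
  by rewrite /L -(ln_exp (alpha * ln (INR n))); apply: ln_le.
have nm : exp (c * L) <= INR n / INR m.
  apply: Rle_divr => //; apply: Rle_trans (_ : exp (c * L) * exp (alpha * L) <= _).
    by apply: Rmult_le_compat_l => //; apply/Rlt_le/exp_pos.
  rewrite -exp_plus; have -> : c * L + alpha * L = L by rewrite /c; ring.
  by rewrite /L exp_ln //; apply: Rle_refl.
(* [exp (c L) >= (c L)^2 / 4 >= (2 + r) L] leaves an exponent of at most [1 - (1 + r) L <= - r], as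
   [L >= 1]. *)
have := exp_ge_sqr (u := c * L) ltac:(nra).
have c2 : 4 * (2 + r) <= L * c ^ 2 by apply: Rdiv_le_mul hL2; nra.
have : alpha * L <= L by nra.
nra.
Qed.

(** With [t = k^2/m] and [q >= 1 - t], the bound [n t <= (1 - eps) ln n] makes the mean number of
    isolated nodes at least [n^(eps/2)] once [ln n] is large, while [1/q - 1 <= 2t] tends to [0]. *)
Lemma connected_small eps eta : 0 < eps < 1 -> 0 < eta ->
  exists L0, forall n m k : nat, (2 <= n)%nat -> (2 <= k)%nat -> (k <= m)%nat ->
    INR k ^ 2 * INR n <= (1 - eps) * (INR m * ln (INR n)) -> L0 <= ln (INR n) ->
    rig_prob k (fun F : assignment n m => rig_connected F) <= eta.
Proof.
move=> eps01 eta0.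
exists (Rmax (8 / eps) ((2 / eps + 8) / eta)) => n m k n2 k2 km kn /Rmax_le_and[hL1 hL2].
have e8 : 8 < 8 / eps by apply: (proj1 (Rlt_div_r 8 8 eps ltac:(lra))); lra.
set L := ln (INR n) in kn hL1 hL2.
have nR : 2 <= INR n := le_INR_nat n2.
have mR : 2 <= INR m by apply: (@le_INR_nat 2); lia.
have nL : exp L = INR n by rewrite /L exp_ln; lra.
have [q] := @rig_prob_connected_le n m k km n2 (ltnW k2).
set t := INR k ^ 2 / INR m => hq hP.
have t0 : 0 <= t by apply: Rdiv_le_0_compat; nra.
have nt : INR n * t <= (1 - eps) * L.
  have -> : INR n * t = INR k ^ 2 * INR n / INR m by rewrite /t; field; lra.
  by apply: Rdiv_lel; nra.
(* This follows from [n = exp L >= L^2 / 4] and [n t <= L]. *)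
have tL : t <= 4 / L.
  apply: Rle_divr; first by lra.
  have := exp_ge_sqr (u := L) ltac:(lra); rewrite nL => h.
  have : INR n * t <= L by nra.
  have : 0 <= t * L by nra.
  nra.
have te : t <= eps / 2.
  apply: Rle_trans tL _; apply: Rdiv_lel; first by lra.
  by have := Rdiv_le_mul (c := eps) ltac:(lra) hL1; lra.
have q0 : 0 < q by lra.
apply: Rle_trans (hP q0) _.
have i1 : / q <= 1 + 2 * t.
  have -> : 1 + 2 * t = / / (1 + 2 * t) by rewrite Rinv_inv.
  apply: Rinv_le_contravar; first by apply: Rinv_0_lt_compat; lra.
  apply: Rle_trans hq; rewrite -[/ _]Rmult_1_l; apply: Rdiv_lel; first by lra.
  nra.
have i2 : exp (- (1 - eps / 2) * L) <= q ^ n.-1.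
  (* [1 + u <= exp u] at [u = t/(1 - t)], inverted, bounds [1 - t] from below. *)
  have qe : exp (- (t / (1 - t))) <= 1 - t.
    rewrite exp_Ropp; apply: Rle_trans (_ : / (1 + t / (1 - t)) <= _); last first.
      by apply: Req_le; field; lra.
    apply: Rinv_le_contravar; last exact: exp_ge1D.
    have : 0 <= t / (1 - t) by apply: Rdiv_le_0_compat; lra.
    lra.
  apply: Rle_trans (_ : exp (- (t / (1 - t))) ^ n.-1 <= _); last first.
    apply: pow_incr; split; [exact/Rlt_le/exp_pos | lra].
  rewrite exp_pow; apply: exp_le.
  have n1 : 0 <= INR n.-1 <= INR n.
    by split; [exact: pos_INR | apply: le_INR_nat; lia].
  have : INR n * (t / (1 - t)) <= (1 - eps / 2) * L.
    have -> : INR n * (t / (1 - t)) = (INR n * t) / (1 - t) by field; lra.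
    apply: Rdiv_lel; first by lra.
    apply: Rle_trans nt _.
    have : 1 - eps <= (1 - eps / 2) * (1 - t) by nra.
    nra.
  have : 0 <= t / (1 - t) by apply: Rdiv_le_0_compat; lra.
  nra.
have i3 : / (INR n * q ^ n.-1) <= 2 / eps / L.
  apply: Rle_trans (_ : / exp (eps / 2 * L) <= _).
    apply: Rinv_le_contravar; first exact: exp_pos.
    have -> : eps / 2 * L = L + - (1 - eps / 2) * L by ring.
    by rewrite exp_plus nL; apply: Rmult_le_compat_l; lra.
  have -> : 2 / eps / L = / (eps / 2 * L) by field; lra.
  by apply: Rinv_le_contravar; [nra | exact: exp_ge_self].
(* The error terms are [2/(eps L)] from the mean and [2t <= 8/L]; their sum dictates the second
   threshold. *)
have : (2 / eps + 8) / L <= eta.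
  apply: Rdiv_lel; first by lra.
  by have := Rdiv_le_mul eta0 hL2; lra.
have -> : (2 / eps + 8) / L = 2 / eps / L + 2 * (4 / L) by field; lra.
lra.
Qed.

(** * Limits in [n] *)

Lemma ln_INR_eventually M : eventually (fun n => M <= ln (INR n)).
Proof.
have [N hN] := nfloor_ex (exp M) (Rlt_le _ _ (exp_pos M)).
exists N.+1 => n /le_INR; rewrite S_INR => h.
by rewrite -(ln_exp M); apply: ln_le; [exact: exp_pos | lra].
Qed.

Lemma is_lim_seq_one (u : nat -> R) :
  (forall eta, 0 < eta -> eventually (fun n => 1 - eta <= u n <= 1)) -> is_lim_seq u 1.
Proof.
move=> h; apply/is_lim_seq_spec => e.
have [N hN] := h (e / 2) ltac:(have := cond_pos e; lra).
exists N => n /hN hn; apply: Rabs_def1; have := cond_pos e; lra.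
Qed.

Lemma LimInf_seq_gt_one u : Rbar_lt (Rbar.Finite 1) (LimInf_seq u) ->
  exists2 eps, 0 < eps <= 1 & eventually (fun n => 1 + eps <= u n).
Proof.
have : is_LimInf_seq u (LimInf_seq u) := proj2_sig (ex_LimInf_seq u);
  case: (LimInf_seq u) => [l||] //= h l1.
  (* At most half of the gap, so that [l - e >= 1 + e]. *)
  pose e := Rmin 1 ((l - 1) / 2).
  have e1 : e <= 1 by exact: Rmin_l.
  have e2 : e <= (l - 1) / 2 by exact: Rmin_r.
  have e0 : 0 < e by apply: Rmin_pos; lra.
  exists e => //; have [_ [N hN]] := h (mkposreal _ e0).
  by exists N => n /hN /=; lra.
exists 1; first by lra.
by have [N hN] := h 2; exists N => n /hN; lra.
Qed.

Lemma LimSup_seq_lt_one u : Rbar_lt (LimSup_seq u) (Rbar.Finite 1) ->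
  exists2 eps, 0 < eps < 1 & eventually (fun n => u n <= 1 - eps).
Proof.
have : is_LimSup_seq u (LimSup_seq u) := proj2_sig (ex_LimSup_seq u);
  case: (LimSup_seq u) => [l||] //= h l1.
  (* Half of the gap gives [l + e <= 1 - e]; the cap [1/2] keeps [eps] below [1]. *)
  pose e := Rmin (/ 2) ((1 - l) / 2).
  have e1 : e <= / 2 by exact: Rmin_l.
  have e2 : e <= (1 - l) / 2 by exact: Rmin_r.
  have e0 : 0 < e by apply: Rmin_pos; lra.
  exists e; first by lra.
  have [_ [N hN]] := h (mkposreal _ e0).
  by exists N => n /hN /=; lra.
exists (/ 2); first by lra.
by have [N hN] := h 0; exists N => n /hN; lra.
Qed.

Theorem theorem1 (alpha : R) (k m : nat -> nat) :
  (0 < alpha)%R ->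
  (forall n : nat, (2 <= k n)%nat) ->
  (forall n : nat, (1 <= n)%nat ->
     (INR (m n) <= Rpower (INR n) alpha < INR (m n) + 1)%R) ->
  (exists N : nat, forall n : nat, (N <= n)%nat -> (k n <= m n)%nat) ->
  (Rbar_lt (Rbar.Finite 1%R)
     (LimInf_seq (fun n => (INR (k n) ^ 2 * INR n / (INR (m n) * ln (INR n)))%R)) ->
   is_lim_seq (fun n => @rig_prob n (m n) (k n) (fun F => rig_connected F)) 1%R)
  /\
  (Rbar_lt
     (LimSup_seq (fun n => (INR (k n) ^ 2 * INR n / (INR (m n) * ln (INR n)))%R))
     (Rbar.Finite 1%R) ->
   is_lim_seq (fun n => @rig_prob n (m n) (k n) (fun F => ~~ rig_connected F)) 1%R).
Proof.
move=> al0 k2 mE [N0 km].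
have km_ev : eventually (fun n => k n <= m n)%nat.
  by exists N0 => n /leP; apply: km.
have n_ev : eventually (fun n => 1 < n)%nat by exists 2%nat => n /leP.
split=> hlim.
- have [eps eps01 eps_ev] := LimInf_seq_gt_one hlim.
  apply: is_lim_seq_one => eta eta0.
  (* [r >= 1] keeps [exp (- r)] below [1/2], as the geometric sum requires. *)
  pose r := Rmax 1 (- ln (eta / 2)).
  have r1 : 1 <= r by exact: Rmax_l.
  have r_eta : 2 * exp (- r) <= eta.
    have h : - ln (eta / 2) <= r by exact: Rmax_r.
    have := exp_le (a := - r) (b := ln (eta / 2)) ltac:(lra).
    by rewrite exp_ln; lra.
  have [L0 hL0] : exists L0, forall n, (0 < n)%nat -> (k n <= m n)%nat ->
      1 + eps <= INR (k n) ^ 2 * INR n / (INR (m n) * ln (INR n)) ->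
      L0 <= ln (INR n) ->
      rig_prob (k n) (fun F : assignment n (m n) => ~~ rig_connected F)
      <= 2 * exp (- r).
    (* Colour sets are used for [alpha < 1], node sets for [alpha >= 1], where [n <= m]. *)
    have [al1|al1] := Rlt_le_dec alpha 1.
      have [L0 hL0] := disconnected_colours_small (conj al0 al1) r1.
      by exists L0 => n n0 kmn _ hL; apply: hL0 => //; case: (mE n n0).
    have [L0 hL0] := disconnected_nodes_small eps01 r1.
    (* The [1] makes [ln n] positive, so that the denominator can be cleared. *)
    exists (Rmax 1 L0) => n n0 kmn heps /Rmax_le_and[hL1 hL].
    have nR : 1 <= INR n := le_INR_nat n0.
    apply: hL0 => //.
      have [_ mn] := mE n n0.
      have := Rle_Rpower _ _ _ nR al1; rewrite Rpower_1; last by lra.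
      (* [n <= n^alpha < m + 1] between integers yields [n <= m]. *)
      move=> h; have /INR_lt/ltP : INR n < INR (m n).+1 by rewrite S_INR; lra.
      by [].
    have mR : 2 <= INR (m n) by apply: (@le_INR_nat 2); apply: leq_trans kmn.
    by apply: Rle_div_mul heps; nra.
  have ev := filter_and _ _ (filter_and _ _ n_ev km_ev)
    (filter_and _ _ eps_ev (ln_INR_eventually L0)).
  have [N hN] := ev; exists N => n /hN[[n0 kmn] [heps hL]].
  have := hL0 n (ltnW n0) kmn heps hL.
  have := rig_prob_ge0 (k n) (fun F : assignment n (m n) => ~~ rig_connected F).
  rewrite (rig_prob_compl kmn (fun F => rig_connected F)); lra.
- have [eps eps01 eps_ev] := LimSup_seq_lt_one hlim.
  apply: is_lim_seq_one => eta eta0.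
  have [L0 hL0] := connected_small eps01 eta0.
  have ev := filter_and _ _ (filter_and _ _ n_ev km_ev)
    (filter_and _ _ eps_ev (ln_INR_eventually (Rmax 1 L0))).
  have [N hN] := ev; exists N => n /hN[[n0 kmn] [heps /Rmax_le_and[hL1 hL]]].
  have mR : 2 <= INR (m n) by apply: (@le_INR_nat 2); apply: leq_trans kmn.
  have {}heps : INR (k n) ^ 2 * INR n <= (1 - eps) * (INR (m n) * ln (INR n)).
    by apply: Rdiv_le_mul heps; nra.
  have := hL0 n (m n) (k n) n0 (k2 n) kmn heps hL.
  have := rig_prob_ge0 (k n) (fun F : assignment n (m n) => rig_connected F).
  rewrite (rig_prob_compl kmn (fun F : assignment n (m n) => rig_connected F)); lra.
Qed.
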